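(* Let $G$ be a (nonempty) Cohen-Macaulay very well-covered graph. Then $G$ has at least two leaves.
   Context: Graphs are finite and simple. A graph $G$ without isolated vertices is very well-covered if $|V(G)|$ is even and every maximal (with respect to inclusion) independent set of $G$ has cardinality $|V(G)|/2$. A leaf is a vertex of degree $1$. Let $K$ be a field and $R$ the polynomial ring over $K$ whose variables are the vertices of $G$; the edge ideal is $I(G)=(uv : uv\in E(G))\subset R$, and $G$ is called Cohen-Macaulay if $R/I(G)$ is a Cohen-Macaulay ring. *)

(* Defs.v *)
From HB Require Import structures.
From mathcomp Require Import all_boot all_order all_algebra.
From mathcomp Require Import boolp.
From mathcomp Require Import mpoly.

Set Implicit Arguments.
Unset Strict Implicit.
Unset Printing Implicit Defensive.

Import GRing.Theory.

Local Open Scope ring_scope.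

Section CohenMacaulayRings.
Variable A : comNzRingType.

Definition ideal_gen (s : seq A) : {pred A} :=
  fun x => `[< exists c : nat -> A, x = \sum_(i < size s) c i * s`_i >].

(* [idealr_closed] only allows proper ideals, and the unit ideal is always
   finitely generated. *)
Definition noetherian : Prop :=
  forall I : {pred A}, idealr_closed I -> exists s : seq A, I =i ideal_gen s.

(* With the classical axioms of [boolp], [{pred A}] ranges over all subsets of
   [A], so the quantifications over ideals below lose nothing. *)
Definition prime_ideal (P : {pred A}) : Prop :=
  idealr_closed P /\ prime_idealr_closed P.

Definition maximal_ideal (M : {pred A}) : Prop :=
  idealr_closed M /\
  forall I : {pred A}, idealr_closed I -> {subset M <= I} -> I =i M.

(* A chain [C 0 < C 1 < ... < C n = P] of primes; the values of [C] beyond [n]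
   are irrelevant. *)
Definition prime_chain (P : {pred A}) (n : nat) (C : nat -> {pred A}) : Prop :=
  [/\ forall i, (i <= n)%N -> prime_ideal (C i),
      forall i, (i < n)%N ->
        {subset C i <= C i.+1} /\ ~ {subset C i.+1 <= C i}
    & C n =i P].

Definition is_height (P : {pred A}) (n : nat) : Prop :=
  (exists C, prime_chain P n C) /\
  (forall m C, prime_chain P m C -> (m <= n)%N).

(* Each [s`_i] is a nonzerodivisor modulo the previous terms, and the whole
   sequence generates a proper ideal. *)
Definition regular_sequence (s : seq A) : Prop :=
  (forall i, (i < size s)%N -> forall x : A,
     s`_i * x \in ideal_gen (take i s) -> x \in ideal_gen (take i s)) /\
  1 \notin ideal_gen s.

Definition is_depth (P : {pred A}) (n : nat) : Prop :=
  (exists s, [/\ regular_sequence s, {subset s <= P} & size s = n]) /\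
  (forall s, regular_sequence s -> {subset s <= P} -> (size s <= n)%N).

(* A noetherian ring [A] is Cohen-Macaulay if depth(M, A) = height(M) for
   every maximal ideal [M] (the global form of the definition, as in Kaplansky
   and Eisenbud; depth(M, A) is the depth of the local ring A_M). *)
Definition cohen_macaulay_ring : Prop :=
  noetherian /\
  forall M : {pred A}, maximal_ideal M ->
    exists n, is_height M n /\ is_depth M n.

Lemma ideal_gen_closed (s : seq A) :
  1 \notin ideal_gen s -> idealr_closed (ideal_gen s).
Proof.
move=> s1; split => //.
  by apply/asboolP; exists (fun=> 0); rewrite big1 // => i _; rewrite mul0r.
move=> a u v /asboolP[c ->] /asboolP[d ->]; apply/asboolP.
exists (fun i => a * c i + d i).
rewrite mulr_sumr -big_split /=.
by apply: eq_bigr => i _; rewrite mulrDl mulrA.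
Qed.

End CohenMacaulayRings.

(* A finite simple graph is a symmetric irreflexive relation [e] on a finite
   type [T]. *)
Section Graphs.
Variables (T : finType) (e : rel T).

Definition simple_graph : Prop := ssrbool.symmetric e /\ irreflexive e.

Definition degree (v : T) : nat := #|[set w | e v w]|.

Definition leaf (v : T) : bool := degree v == 1%N.

Definition independent (S : {set T}) : bool :=
  [forall u in S, forall v in S, ~~ e u v].

Definition very_well_covered : Prop :=
  [/\ forall v : T, degree v != 0%N,
      ~~ odd #|T|
    & forall S : {set T}, maxset independent S -> #|S| = #|T|./2].

End Graphs.

Section EdgeIdeals.
Variables (K : fieldType) (T : finType) (e : rel T).

(* The variable attached to the vertex [v]. *)
Definition vertex_var (v : T) : {mpoly K[#|T|]} := 'X_(enum_rank v).

Definition edge_ideal : {pred {mpoly K[#|T|]}} :=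
  ideal_gen [seq vertex_var p.1 * vertex_var p.2
            | p <- enum [pred p : T * T | e p.1 p.2]].

Lemma edge_ideal_closed : idealr_closed edge_ideal.
Proof.
apply: ideal_gen_closed; apply/negP => /asboolP[c].
move/(congr1 (meval (fun=> 0))); rewrite meval1 raddf_sum big1 /= => [|i _].
  by move/eqP; rewrite oner_eq0.
rewrite mevalM; set s := (X in nth 0 X _).
have /mapP[p _ ->] : s`_i \in s by apply: mem_nth.
by rewrite mevalM /vertex_var mevalXU mul0r mulr0.
Qed.

HB.instance Definition _ :=
  isIdealr.Build {mpoly K[#|T|]} edge_ideal edge_ideal_closed.

Definition edge_ring : comNzRingType := {ideal_quot edge_ideal}.

Definition cohen_macaulay_graph : Prop := cohen_macaulay_ring edge_ring.

End EdgeIdeals.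

(* Main.v *)
Require Import Defs.
From mathcomp Require Import all_boot all_order all_algebra.
From HB Require Import structures.
From mathcomp Require Import boolp mpoly.
From mathcomp Require Import ring zify.

(* By Hall's theorem a very well-covered graph has a perfect matching
   [v <-> s v], and every maximal independent set contains exactly one end of
   each matching edge.  Hence [e u x] and [e w (s x)] imply [e u w], so that
   [e (s v) w] means N(v) <= N(w).

   If two distinct vertices had the same neighbourhood, some independent set F
   of size n - m with m >= 2, where 2n is the number of vertices, would leave,
   after removal of F and its neighbours, a complete bipartite graph on X and
   Y.  At the point with coordinates 1 on F and 0 elsewhere the edge ring has
   height >= n, but the elements f - 1 (f in F) followed by x + y (x in X,
   y in Y) form a regular sequence modulo which x is nonzero and killed by the
   maximal ideal.  Koszul cohomology then bounds the length of every regular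
   sequence in that maximal ideal by n - m + 1 < n, and the graph is not
   Cohen-Macaulay.

   So neighbourhoods are distinct, and a vertex of minimal degree among those
   with neighbourhood inside N(v) is a leaf l, as N(s z) <= N(l) for every z in
   N(l).  Applying this to some v, and then to s l, gives two leaves, which
   differ because s l is not its own neighbour. *)

Set Implicit Arguments.
Unset Strict Implicit.
Unset Printing Implicit Defensive.

Import GRing.Theory.

(** * Matchings in very well-covered graphs *)

Section Hall.
Variable T : finType.
Implicit Types (r : rel T) (A B : {set T}).

Definition neighbours r A := [set y | [exists x in A, r x y]].

Lemma neighboursP r A y :
  reflect (exists2 x, x \in A & r x y) (y \in neighbours r A).
Proof. by rewrite inE; apply: (iffP exists_inP). Qed.

Lemma neighboursS r A B : A \subset B -> neighbours r A \subset neighbours r B.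
Proof.
move=> AB; apply/subsetP=> y /neighboursP[x xA rxy]; apply/neighboursP.
by exists x => //; apply: (subsetP AB).
Qed.

(** Induction on [#|A|]. If a nonempty [B] inside [A :\ x] is tight, [B] and [A :\: B] are matched
    separately, the latter outside the neighbours of [B]. Otherwise every such set has a spare
    neighbour, so [x] may take any neighbour [y], which is then deleted. *)
Theorem hall r A :
  (forall B, B \subset A -> #|B| <= #|neighbours r B|) ->
  exists f : T -> T, {in A &, injective f} /\ {in A, forall x, r x (f x)}.
Proof.
have [n] := ubnP #|A|; elim: n r A => // n IHn r A; rewrite ltnS => An hallA.
have [->|[x xA]] := set_0Vmem A.
  by exists id; split=> [x y|x]; rewrite inE.
have xA1 : #|[set x]| <= #|neighbours r [set x]|.
  by apply: hallA; rewrite sub1set.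
have [y /neighboursP[_ /set1P-> rxy]] : exists y, y \in neighbours r [set x].
  by apply/set0Pn; rewrite -card_gt0; apply: leq_trans xA1; rewrite cards1.
have [/existsP[B /and3P[BA B0 NB]]|tight] := boolP [exists B : {set T},
  [&& B \subset A :\ x, B != set0 & #|neighbours r B| <= #|B|]].
  have BA' : B \subset A by apply: subset_trans BA (subsetDl _ _).
  have ltB : #|B| < #|A|.
    apply: leq_ltn_trans (subset_leq_card BA) _.
    by rewrite [X in _ < X](cardsD1 x) xA.
  have [|C CB|f1 [f1I f1r]] := IHn r B.
  - exact: leq_trans ltB An.
  - by apply: hallA; apply: subset_trans BA'.
  have [|C CA|f2 [f2I f2r]] :=
    IHn (fun u v => r u v && (v \notin neighbours r B)) (A :\: B).
  - apply: leq_trans An; rewrite cardsD (setIidPr BA').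
    by move: B0; rewrite -card_gt0; have := subset_leq_card BA'; lia.
  - have CB0 : C :&: B = set0.
      apply/setP=> z; rewrite !inE; apply/negP=> /andP[zC zB].
      by have := subsetP CA _ zC; rewrite inE zB.
    have := hallA (C :|: B); rewrite cardsU CB0 cards0 subn0.
    have -> : C :|: B \subset A.
      by rewrite subUset BA' andbT; apply: subset_trans CA (subsetDl _ _).
    move=> /(_ isT) cU.
    pose N : {set T} :=
      neighbours (fun u v => r u v && (v \notin neighbours r B)) C.
    rewrite -/N.
    have : neighbours r (C :|: B) \subset N :|: neighbours r B.
      apply/subsetP=> z /neighboursP[w]; rewrite in_setU => wCB rwz.
      rewrite in_setU; case: (boolP (z \in neighbours r B)) => [|zB].
        by rewrite orbT.
      case/orP: wCB => [wC|wB].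
        by apply/orP; left; apply/neighboursP; exists w => //; rewrite rwz.
      by case/negP: zB; apply/neighboursP; exists w.
    move/subset_leq_card => cN; have := leq_trans cN (leq_card_setU _ _).
    by lia.
  have f2P u : u \in A -> u \notin B ->
      r u (f2 u) && (f2 u \notin neighbours r B).
    by move=> uA uB; apply: f2r; rewrite inE uB.
  have sep u v : u \in B -> v \in A -> v \notin B -> f1 u <> f2 v.
    move=> uB vA vB uv; have /andP[_ /negP] := f2P v vA vB.
    by apply; rewrite -uv; apply/neighboursP; exists u => //; apply: f1r.
  exists (fun u => if u \in B then f1 u else f2 u); split.
    move=> u v uA vA; case: ifP => [uB|/negbT uB]; case: ifP => [vB|/negbT vB].
    - exact: f1I.
    - by move/sep => /(_ uB vA vB).
    - by move/esym/sep => /(_ vB uA uB).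
    - by apply: f2I; rewrite inE ?uB ?vB.
  move=> u uA; case: ifP => [uB|/negbT uB]; first exact: f1r.
  by have /andP[] := f2P u uA uB.
have [|C CA|f [fI fr]] := IHn (fun u v => r u v && (v != y)) (A :\ x).
- by rewrite (cardsD1 x) xA in An.
- have [->|C0] := eqVneq C set0; first by rewrite cards0.
  have : #|C| < #|neighbours r C|.
    rewrite ltnNge; apply: contra tight => NC; apply/existsP; exists C.
    by rewrite CA C0 NC.
  pose N : {set T} := neighbours (fun u v => r u v && (v != y)) C; rewrite -/N.
  have : neighbours r C \subset y |: N.
    apply/subsetP=> z /neighboursP[w wC rwz]; rewrite !in_setU1.
    case: eqVneq => //= zy; apply/neighboursP; exists w => //.
    by rewrite rwz zy.
  move/subset_leq_card; rewrite cardsU1; case: (_ \notin _) => /=; lia.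
have frP u : u \in A -> u != x -> r u (f u) && (f u != y).
  by move=> uA ux; apply: fr; rewrite !inE ux.
exists (fun u => if u == x then y else f u); split.
  have fy v : v \in A -> v != x -> f v != y by move=> vA /(frP v vA) /andP[].
  move=> u v uA vA; case: eqVneq => [->|ux]; case: eqVneq => [->|vx] //.
  - by move/esym/eqP; rewrite (negbTE (fy _ vA vx)).
  - by move/eqP; rewrite (negbTE (fy _ uA ux)).
  - by apply: fI; rewrite !inE ?ux ?vx.
move=> u uA; case: eqVneq => [->//|ux].
by have /andP[] := frP u uA ux.
Qed.

End Hall.

(** * Perfect matchings, inclusion of neighbourhoods, and twins *)

Section VeryWellCovered.
Variables (T : finType) (e : rel T).
Hypothesis eG : simple_graph e.
Implicit Types (S A : {set T}) (u v w x y z : T).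

Local Notation indep := (independent e).

Lemma edgeC u v : e u v = e v u. Proof. by case: eG => /(_ u v). Qed.

Lemma edgexx u : e u u = false. Proof. by case: eG => _ ->. Qed.

Lemma independentP S :
  reflect (forall u v, u \in S -> v \in S -> ~~ e u v) (indep S).
Proof.
apply: (iffP forall_inP) => [h u v uS vS|h u uS].
  by have /forall_inP := h u uS; apply.
by apply/forall_inP => v vS; apply: h.
Qed.

Lemma independentS S A : A \subset S -> indep S -> indep A.
Proof.
move=> /subsetP AS /independentP iS; apply/independentP=> u v uA vA.
by apply: iS; apply: AS.
Qed.

Hypothesis eW : very_well_covered e.

Lemma neighbour_exists v : exists w, e v w.
Proof.
case: eW => /(_ v) + _ _; rewrite -lt0n card_gt0 => /set0Pn[w].
by rewrite inE => vw; exists w.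
Qed.

Lemma card_maxindep S : maxset indep S -> #|S| = #|T|./2.
Proof. by case: eW => _ _; apply. Qed.

Lemma card_indep S : indep S -> #|S| <= #|T|./2.
Proof.
move=> iS; have [S' mS' SS'] := maxset_exists iS.
by rewrite -(card_maxindep mS') subset_leq_card.
Qed.

Lemma independent1 v : indep [set v].
Proof. by apply/independentP=> x y /set1P-> /set1P->; rewrite edgexx. Qed.

(** Induction on [#|A|], with [S] a maximal independent set that misses some [a] in [A]. Replacing
    [S :&: neighbours e A] by [A] keeps independence, so [#|A :\: S|] is at most the size of the
    part removed. The remaining [A :&: S] is smaller, and its neighbours avoid [S]. *)
Lemma card_indep_neighbours A : indep A -> #|A| <= #|neighbours e A|.
Proof.
have [n] := ubnP #|A|; elim: n A => // n IHn A; rewrite ltnS => An iA.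
have [->|[a aA]] := set_0Vmem A; first by rewrite cards0.
have [w aw] := neighbour_exists a.
have [S mS /subsetP/(_ w)] := maxset_exists (independent1 w).
rewrite inE eqxx => /(_ isT) wS.
have /independentP iS := maxsetp mS.
set Q := S :&: neighbours e A.
have iSA : indep ((S :\: neighbours e A) :|: A).
  have NA u v : u \in S :\: neighbours e A -> v \in A -> ~~ e v u.
    rewrite inE => /andP[uN _] vA; apply: contra uN => vu.
    by apply/neighboursP; exists v.
  apply/independentP=> u v; rewrite 2!(in_setU _ _ A) => /orP[uS|uA] /orP[vS|vA].
  - by apply: iS; [move: uS | move: vS]; rewrite inE => /andP[].
  - by rewrite edgeC; apply: NA.
  - exact: NA.
  - exact: (independentP _ iA).
have cSA : #|A :\: S| <= #|Q|.
  have : #|(S :\: neighbours e A) :|: A| <= #|S|.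
    by rewrite (card_maxindep mS); apply: card_indep.
  have sub : (S :\: neighbours e A) :|: (A :\: S) \subset
             (S :\: neighbours e A) :|: A.
    by apply: setUS; apply: subsetDl.
  have dis : (S :\: neighbours e A) :&: (A :\: S) = set0.
    by apply/setP=> z; rewrite !inE; case: (z \in S); rewrite /= ?andbF.
  have := subset_leq_card sub; rewrite cardsU dis cards0 subn0.
  have := cardsID (neighbours e A) S; rewrite -/Q; lia.
have ltAS : #|A :&: S| < #|A|.
  apply: proper_card; apply/properP; split; first exact: subsetIl.
  exists a => //; rewrite inE aA /=; apply/negP => aS.
  by have := iS _ _ aS wS; rewrite aw.
have cAS : #|A :&: S| <= #|neighbours e (A :&: S)|.
  apply: IHn; first exact: leq_trans ltAS An.
  by apply: (@independentS A) => //; apply: subsetIl.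
have sub : neighbours e (A :&: S) \subset neighbours e A :\: S.
  apply/subsetP=> z /neighboursP[x]; rewrite !in_setI => /andP[xA xS] xz.
  rewrite in_setD; apply/andP; split; last by apply/neighboursP; exists x.
  by apply/negP => zS; have := iS _ _ xS zS; rewrite xz.
have := subset_leq_card sub.
have := cardsID S A; have := cardsID S (neighbours e A).
by rewrite [neighbours e A :&: S]setIC -/Q; lia.
Qed.

(** Hall's theorem injects a maximal independent set [S] into its complement; since [S] holds half
    of the vertices, the injection is onto. *)
Lemma perfect_matching :
  exists s : T -> T, involutive s /\ forall v, e v (s v).
Proof.
have ind0 : indep set0 by apply/independentP=> u v; rewrite inE.
have [S mS _] := maxset_exists ind0.
have /independentP iS := maxsetp mS.
have [B BS|f [fI fe]] := @hall _ e S.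
  exact: card_indep_neighbours (independentS BS (maxsetp mS)).
have fS x : x \in S -> f x \notin S.
  by move=> xS; apply/negP => fxS; have := iS _ _ xS fxS; rewrite fe.
have cover v : v \notin S -> exists2 x, x \in S & v = f x.
  move=> vS; suff: v \in f @: S by case/imsetP=> x xS ->; exists x.
  suff <- : ~: S = f @: S by rewrite inE.
  apply/esym/eqP; rewrite eqEcard; apply/andP; split.
    by apply/subsetP=> _ /imsetP[x xS ->]; rewrite inE fS.
  rewrite card_in_imset // cardsCs setCK.
  have [_ evT _] := eW; rewrite (card_maxindep mS).
  by have := odd_double_half #|T|; rewrite (negbTE evT) -addnn; lia.
(* [g] inverts [f] on the complement of [S], where [cover] keeps the default [v] from being
   reached. *)
pose g v := odflt v [pick x in S | f x == v].
have gf x : x \in S -> g (f x) = x.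
  move=> xS; rewrite /g; case: pickP => [y /andP[yS /eqP]|/(_ x)] /=.
    exact: fI.
  by rewrite xS eqxx.
exists (fun v => if v \in S then f v else g v); split=> v.
  case: (boolP (v \in S)) => vS; first by rewrite (negbTE (fS _ vS)) gf.
  by have [x xS ->] := cover v vS; rewrite gf // xS.
case: (boolP (v \in S)) => vS; first exact: fe.
by have [x xS ->] := cover v vS; rewrite gf // edgeC fe.
Qed.

Variable s : T -> T.
Hypotheses (sK : involutive s) (es : forall v, e v (s v)).

(** [S] and its image under [s] are disjoint, and each holds half of the vertices. *)
Lemma maxindep_partner S v : maxset indep S -> v \notin S -> s v \in S.
Proof.
move=> mS; have /independentP iS := maxsetp mS.
have dis : S :&: s @: S = set0.
  apply/setP=> x; rewrite !inE; apply/negP => /andP[xS /imsetP[y yS xy]].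
  by have := iS _ _ yS xS; rewrite xy es.
have : S :|: s @: S = [set: T].
  apply/eqP; rewrite eqEcard subsetT cardsU dis cards0 subn0.
  rewrite card_imset; last exact: inv_inj.
  have [_ evT _] := eW; rewrite (card_maxindep mS) cardsT.
  by have := odd_double_half #|T|; rewrite (negbTE evT) -addnn; lia.
move/setP/(_ v); rewrite !inE => /orP[->//|/imsetP[y yS ->] _].
by rewrite sK.
Qed.

(* Favaron's property of perfect matchings. *)
Lemma partner_join x u w : e u x -> e w (s x) -> e u w.
Proof.
move=> ux wsx; apply/negPn/negP => uw.
have iuw : indep [set u; w].
  apply/independentP=> a b; rewrite !inE.
  by move=> /orP[]/eqP-> /orP[]/eqP->; rewrite ?edgexx // edgeC.
have [S mS /subsetP sub] := maxset_exists iuw.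
have /independentP iS := maxsetp mS.
have uS : u \in S by apply: sub; rewrite !inE eqxx.
have wS : w \in S by apply: sub; rewrite !inE eqxx orbT.
have xS : x \notin S by apply/negP => xS; have := iS _ _ uS xS; rewrite ux.
have := iS _ _ wS (maxindep_partner mS xS).
by rewrite wsx.
Qed.

(** Favaron's property along the matching edge of [v] turns adjacency into inclusion of
    neighbourhoods. *)
Lemma partner_le v w : e (s v) w <-> (forall z, e v z -> e w z).
Proof.
split=> [svw z vz|]; last by move/(_ (s v) (es v)); rewrite edgeC.
by apply: (@partner_join (s v)); rewrite ?sK edgeC.
Qed.

(** Descent on the degree: a non-leaf [v] has a neighbour [z] other than [s v], and the
    neighbourhood of [s z] lies in that of [v], properly because there are no twins. *)
Lemma leaf_below v : (forall x y, e x =1 e y -> x = y) ->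
  exists2 l, leaf e l & forall z, e l z -> e v z.
Proof.
move=> twin_free; have [n] := ubnP (degree e v).
elim: n v => // n IHn v; rewrite ltnS => vn.
have [lv|nlv] := boolP (leaf e v); first by exists v.
have svN : s v \in [set w | e v w] by rewrite inE es.
have [z]: exists z, z \in [set w | e v w] :\ s v.
  apply/set0Pn; rewrite -card_gt0; move: nlv; rewrite /leaf /degree.
  by rewrite (cardsD1 (s v)) svN; case: #|_|.
rewrite !inE => /andP[zsv vz].
have szv : forall t, e (s z) t -> e v t by apply/partner_le; rewrite sK edgeC.
have [|l ll lsz] := IHn (s z).
  apply: leq_trans vn; apply: proper_card; apply/properP; split.
    by apply/subsetP=> t; rewrite !inE => /szv.
  case: (pickP (fun t => e v t && ~~ e (s z) t)) => [t /andP[vt szt]|h].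
    by exists t; rewrite inE.
  case/eqP: zsv; rewrite -(sK z); congr s; apply: twin_free => t.
  apply/idP/idP => [/szv//|vt]; have := h t; rewrite vt /=.
  by move/negbFE.
by exists l => // t /lsz /szv.
Qed.

Lemma two_leaves : 0 < #|T| -> (forall x y, e x =1 e y -> x = y) ->
  1 < #|[set v | leaf e v]|.
Proof.
move=> /card_gt0P[v _] tf.
have [l ll _] := leaf_below v tf; have [k lk kl] := leaf_below (s l) tf.
apply/card_gt1P; exists l, k; rewrite !inE; split=> //.
apply/eqP => lk'; rewrite -lk' in kl.
by have := kl _ (es l); rewrite edgexx.
Qed.

(* [X] is the class of twins of [v], [Y] consists of their partners, and [F]
   completes [X] to a maximal independent set that avoids the other neighbours
   of [s v] because it contains their partners. *)
Lemma twin_split v w : v != w -> e v =1 e w ->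
  exists F X Y : {set T},
    [/\ [/\ indep (F :|: X), indep (F :|: Y), #|F :|: X| = #|T|./2
          & #|F|.+1 < #|T|./2],
        [disjoint F & X], [disjoint F & Y], [disjoint X & Y]
      & [/\ X != set0, Y != set0, {in X & Y, forall x y, e x y}
          & forall u, u \notin F -> u \notin X -> u \notin Y ->
            exists2 f, f \in F & e f u]].
Proof.
move=> vw tw.
pose C := [set c | [forall z, e c z == e v z]].
have CP c : reflect (e c =1 e v) (c \in C).
  by rewrite inE; apply: (iffP forallP) => h z; apply/eqP; rewrite h.
pose L := [set s y | y in [set y | e (s v) y] :\: C].
have LP y : e (s v) y -> y \notin C -> s y \in L.
  by move=> svy yC; apply/imsetP; exists y => //; rewrite in_setD yC inE.
have iCL : indep (C :|: L).
  (* An edge from [c] to [s y] would put the neighbourhood of [y] inside that of [v]; the edge from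
     [s v] to [y] gives the reverse inclusion, so [y] would lie in [C]. *)
  have CL c l : c \in C -> l \in L -> ~~ e c l.
    move=> /CP cv /imsetP[y]; rewrite in_setD inE => /andP[yC svy ->].
    rewrite cv; apply: contra yC; rewrite edgeC => /partner_le yv.
    apply/CP => z; apply/idP/idP; first exact: yv.
    by move/partner_le: svy; apply.
  apply/independentP=> a b; rewrite !in_setU => /orP[aC|aL] /orP[bC|bL].
  - by rewrite (CP _ aC) edgeC (CP _ bC) edgexx.
  - exact: CL.
  - by rewrite edgeC; apply: CL.
  - case/imsetP: aL => y; rewrite in_setD inE => /andP[yC svy ->].
    case/imsetP: bL => y'; rewrite in_setD inE => /andP[yC' svy' ->].
    apply/negP => yy'.
    have svsy : e (s y) (s v).
      by rewrite edgeC; apply: (@partner_join y') => //.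
    (* Favaron's property with equal ends: no vertex is adjacent to both [y] and [s y]. *)
    have := @partner_join y (s v) (s v) svy.
    by rewrite edgeC svsy edgexx => /(_ isT).
have [S mS sub] := maxset_exists iCL.
have /independentP iS := maxsetp mS.
have CS : C \subset S by apply: subset_trans sub; apply: subsetUl.
have LS : L \subset S by apply: subset_trans sub; apply: subsetUr.
pose Y := [set s c | c in C].
have eSF : (S :\: C) :|: C = S by rewrite setUC -{1}(setIidPr CS) setID.
have vC : v \in C by apply/CP.
have wC : w \in C by apply/CP => z; rewrite tw.
(* Such an [f] would be a neighbour of [s v] outside [C], so its own neighbour [s f] would lie in
   [L], hence in [S] together with [f]. *)
have NC c f : c \in C -> f \in S :\: C -> ~~ e (s c) f.
  move=> cC; rewrite in_setD => /andP[fC fS]; apply/negP => scf.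
  have svf : e (s v) f.
    by apply/partner_le => z; rewrite -(CP _ cC); apply/partner_le: z.
  have := subsetP LS _ (LP _ svf fC) => sfS.
  by have := iS _ _ fS sfS; rewrite es.
have XY : {in C & Y, forall x y, e x y}.
  move=> x _ xC /imsetP[c cC ->]; rewrite (CP _ xC) -(CP _ cC); exact: es.
have YC c : c \in C -> s c \notin S.
  move=> cC; apply/negP => scS.
  by have := iS _ _ (subsetP CS _ cC) scS; rewrite es.
exists (S :\: C), C, Y; split.
- split; rewrite ?eSF //.
  + exact: maxsetp mS.
  + apply/independentP=> a b; rewrite !(in_setU _ _ Y) => /orP[aF|aY] /orP[bF|bY].
    * by apply: iS; [move: aF|move: bF]; rewrite in_setD => /andP[].
    * by case/imsetP: bY => c cC ->; rewrite edgeC; apply: NC.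
    * by case/imsetP: aY => c cC ->; apply: NC.
    * case/imsetP: aY => c cC ->; case/imsetP: bY => d dC ->.
      apply/negP => cd; have := @partner_join (s d) (s c) (s c) cd.
      by rewrite sK edgexx edgeC XY ?imset_f // => /(_ isT).
  + exact: card_maxindep.
  + rewrite -(card_maxindep mS) cardsD (setIidPr CS).
    have : 1 < #|C| by apply/card_gt1P; exists v, w.
    by have := subset_leq_card CS; lia.
- rewrite -setI_eq0; apply/eqP/setP=> z; rewrite in_setI in_setD in_set0.
  by case: (z \in C); rewrite ?andbF.
- rewrite -setI_eq0; apply/eqP/setP=> z; rewrite in_setI in_setD in_set0.
  apply/negP => /andP[/andP[_ zS] /imsetP[c cC zc]].
  by have := YC _ cC; rewrite -zc zS.
- rewrite -setI_eq0; apply/eqP/setP=> z; rewrite in_setI in_set0.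
  apply/negP => /andP[/(subsetP CS) zS /imsetP[c cC zc]].
  by have := YC _ cC; rewrite -zc zS.
- split=> //.
  + by apply/set0Pn; exists v.
  + by apply/set0Pn; exists (s v); apply: imset_f.
  + move=> u uF uC uY; exists (s u); last by rewrite edgeC.
    have uS : u \notin S by move: uF; rewrite in_setD uC.
    rewrite in_setD (maxindep_partner mS uS) andbT.
    by apply: contra uY => suC; apply/imsetP; exists (s u); rewrite ?sK.
Qed.

End VeryWellCovered.

Local Open Scope ring_scope.
Local Open Scope quotient_scope.

(** * Koszul cohomology and regular sequences *)

Section Koszul.
Variable R : comNzRingType.
Implicit Types (a : seq R) (f g : seq bool -> R) (s : seq bool).
Implicit Types (J : R -> Prop).

Definition is_ideal J :=
  [/\ J 0, forall x y, J x -> J y -> J (x + y) & forall c x, J x -> J (c * x)].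

Lemma ideal0 J : is_ideal J -> J 0. Proof. by case. Qed.

Lemma idealD J x y : is_ideal J -> J x -> J y -> J (x + y).
Proof. by case=> _ + _; apply. Qed.

Lemma idealM J c x : is_ideal J -> J x -> J (c * x).
Proof. by case=> _ _; apply. Qed.

Lemma idealN J x : is_ideal J -> J x -> J (- x).
Proof. by move=> Ji Jx; rewrite -mulN1r; apply: idealM. Qed.

Lemma idealB J x y : is_ideal J -> J x -> J y -> J (x - y).
Proof. by move=> Ji Jx Jy; apply: idealD => //; apply: idealN. Qed.

(* A cochain of the Koszul complex of [a] is a function on subsets of the
   indices of [a], encoded as bit sequences of length [size a]; its degree is
   the number of [true] bits. *)
Fixpoint koszul a f s : R :=
  match a, s with
  | x :: a', b :: s' =>
      if b then x * f (false :: s') - koszul a' (fun t => f (true :: t)) s'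
      else koszul a' (fun t => f (false :: t)) s'
  | _, _ => 0
  end.

(** Interior multiplication by the [i]-th basis vector; the sign counts the [true] bits before
    position [i]. *)
Fixpoint contract (i : nat) f s : R :=
  match s, i with
  | [::], _ => 0
  | b :: s', 0%N => if b then 0 else f (true :: s')
  | b :: s', i'.+1 =>
      let c := contract i' (fun t => f (b :: t)) s' in if b then - c else c
  end.

Lemma koszul_linear a c f g s :
  koszul a (fun t => c * f t + g t) s = c * koszul a f s + koszul a g s.
Proof.
elim: a f g s => [|x a IHa] f g [|[] s] /=; rewrite ?mulr0 ?addr0 //.
by rewrite IHa; ring.
Qed.

Lemma contract_linear i c f g s :
  contract i (fun t => c * f t + g t) s = c * contract i f s + contract i g s.
Proof.
elim: i f g s => [|i IHi] f g [|[] s] /=; rewrite ?mulr0 ?addr0 //.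
by rewrite IHi; ring.
Qed.

Lemma eq_koszul a f g s : f =1 g -> koszul a f s = koszul a g s.
Proof. by move=> /funext ->. Qed.

Lemma eq_contract i f g s : f =1 g -> contract i f s = contract i g s.
Proof. by move=> /funext ->. Qed.

Lemma koszul_const0 a s : koszul a (fun=> 0) s = 0.
Proof.
by elim: a s => [|x a IHa] [|[] s] //=; rewrite mulr0 IHa subr0.
Qed.

Lemma contract_const0 i s : contract i (fun=> 0) s = 0.
Proof. by elim: i s => [|i IHi] [|[] s] //=; rewrite IHi oppr0. Qed.

Lemma koszulZ a c f s : koszul a (fun t => c * f t) s = c * koszul a f s.
Proof.
rewrite -[RHS]addr0 -(koszul_const0 a s) -koszul_linear.
by apply: eq_koszul => t; rewrite addr0.
Qed.

Lemma koszulB a f g s :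
  koszul a (fun t => f t - g t) s = koszul a f s - koszul a g s.
Proof.
rewrite addrC -mulN1r -koszul_linear.
by apply: eq_koszul => t; rewrite mulN1r addrC.
Qed.

Lemma koszul_koszul a f s : koszul a (koszul a f) s = 0.
Proof.
elim: a f s => [|x a IHa] f [|[] s] //=.
by rewrite koszulB koszulZ IHa subr0 subrr.
Qed.

(** Cartan's homotopy formula, with contraction as the homotopy. *)
Lemma koszul_contract a i f s : size s = size a -> (i < size a)%N ->
  koszul a (contract i f) s + contract i (koszul a f) s = a`_i * f s.
Proof.
elim: a i f s => [|x a IHa] [|i] f [|[] s] //= [sz]; rewrite ?ltnS => ia.
- by rewrite koszul_const0; ring.
- by ring.
- rewrite -(IHa i (fun t => f (true :: t)) s sz ia).
  rewrite (eq_koszul _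
    (g := fun t => -1 * contract i (fun t => f (true :: t)) t));
    last by move=> t; rewrite mulN1r.
  rewrite koszulZ.
  (* The trailing [0] gives the shape [c * f + g] twice over, so that [contract_linear] reaches
     every term. *)
  rewrite (eq_contract i
    (f := fun t => x * f (false :: t) - koszul a (fun t => f (true :: t)) t)
    (g := fun t => x * f (false :: t) +
                   (-1 * koszul a (fun t => f (true :: t)) t + 0)));
    last by move=> t; rewrite addr0 mulN1r.
  rewrite !contract_linear contract_const0; ring.
- by rewrite -(IHa i (fun t => f (false :: t)) s sz ia).
Qed.

Definition in_degree a j J f :=
  forall s, size s = size a -> count id s = j -> J (f s).

Lemma koszul_degree0 a f s : count id s = 0 -> koszul a f s = 0.
Proof. by elim: a f s => [|x a IHa] f [|[] s] //=; rewrite add0n; apply: IHa. Qed.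

Lemma koszul_degree a j J f : is_ideal J ->
  in_degree a j J f -> in_degree a j.+1 J (koszul a f).
Proof.
move=> Ji; elim: a j f => [|x a IHa] j f fj [|[] s] //= [sz].
- move=> [ct]; apply: idealB => //.
    by apply: idealM => //; apply: fj; rewrite /= ?sz.
  case: j fj ct => [|j] fj ct; first by rewrite koszul_degree0 //; apply: ideal0.
  by apply: (IHa j) => // t tz tc; apply: fj; rewrite /= ?tz ?tc.
- rewrite add0n => ct; apply: (IHa j) => // t tz tc.
  by apply: fj; rewrite /= ?tz.
Qed.

Lemma contract_degree a i j J f : is_ideal J ->
  in_degree a j.+1 J f -> in_degree a j J (contract i f).
Proof.
move=> Ji; elim: a i j f => [|x a IHa] i j f fj [|b s] //=.
  by case: i => *; apply: ideal0.
case: i => [|i] [sz] ct.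
  case: b ct => ct; first exact: ideal0.
  by apply: fj; rewrite /= ?sz -?ct.
case: b ct => ct.
  apply: idealN => //; case: j fj ct => // j fj [ct].
  by apply: (IHa i j) => // t tz tc; apply: fj; rewrite /= ?tz ?tc.
by apply: (IHa i j) => // t tz tc; apply: fj; rewrite /= ?tz ?tc.
Qed.

(** Vanishing of the degree [j] Koszul cohomology of [a] with coefficients in R/J. *)
Definition koszul_exact a J j :=
  forall f, in_degree a j.+1 J (koszul a f) ->
  exists g, in_degree a j J (fun s => f s - koszul a g s).

Definition regular_step J b J' :=
  (forall x, J' x <-> exists c y, J y /\ x = b * c + y) /\
  (forall x, J (b * x) -> J x).

(** The cofactors of [b] are chosen value by value, with 0 outside the degree concerned; this is the
    lifting behind the connecting map. *)
Lemma in_degree_lift a j J b J' f : regular_step J b J' ->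
  in_degree a j J' f -> exists g, in_degree a j J (fun s => f s - b * g s).
Proof.
move=> [J'P _] fJ.
have /choice[g gP] : forall s, exists c,
    size s = size a -> count id s = j -> J (f s - b * c).
  move=> s; have [/andP[/eqP sz /eqP ct]|nst] :=
    boolP ((size s == size a) && (count id s == j)).
    have /J'P[c [y [Jy ->]]] := fJ s sz ct.
    by exists c => _ _; rewrite addrC addKr.
  by exists 0 => sz ct; rewrite sz ct !eqxx in nst.
by exists g.
Qed.

(* The long exact sequence of [0 -> R/J -> R/J -> R/J' -> 0]. *)
Lemma koszul_exact_step a J b J' j : is_ideal J -> regular_step J b J' ->
  koszul_exact a J j -> koszul_exact a J j.+1 -> koszul_exact a J' j.
Proof.
move=> Ji st exj exj1 f /(in_degree_lift st)[g gP].
have [J'P nzd] := st.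
(* [g] represents the image of [f] under the connecting map; differentiating [koszul a f - b * g]
   and cancelling [b] makes it a cocycle. *)
have dg : in_degree a j.+2 J (koszul a g).
  move=> s sz ct; apply: nzd.
  have := koszul_degree Ji gP sz ct.
  rewrite koszulB koszul_koszul koszulZ sub0r => /(idealN Ji).
  by rewrite opprK.
have [h hP] := exj1 g dg.
(* Once [g] is the coboundary of [h] modulo [J], subtracting [b * h] turns [f] into a cocycle modulo
   [J]. *)
have [|k kP] := exj (fun s => f s - b * h s).
  move=> s sz ct; rewrite koszulB koszulZ.
  have -> : koszul a f s - b * koszul a h s =
    (koszul a f s - b * g s) + b * (g s - koszul a h s) by ring.
  by apply: idealD => //; [apply: gP | apply: idealM => //; apply: hP].
exists k => s sz ct; apply/J'P.
exists (h s), (f s - b * h s - koszul a k s); split; first exact: kP.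
by ring.
Qed.

(* Multiplication by [a`_i] is null-homotopic on the Koszul complex, hence zero
   on its cohomology. *)
Lemma koszul_exact_regular a (I : nat -> R -> Prop) :
    (forall i, is_ideal (I i)) ->
    (forall i, (i < size a)%N -> regular_step (I i) a`_i (I i.+1)) ->
  forall j i, (i + j < size a)%N -> koszul_exact a (I i) j.
Proof.
move=> Ii st; elim=> [|j IHj] i ij f df.
  exists (fun=> 0) => s sz ct; rewrite koszul_const0 subr0.
  rewrite addn0 in ij; have [_ nzd] := st i ij; apply: nzd.
  rewrite -(koszul_contract _ sz ij) koszul_degree0 // add0r.
  exact: (contract_degree i (Ii i) df sz ct).
have ia : (i < size a)%N by apply: leq_ltn_trans ij; apply: leq_addr.
have [IP nzd] := st i ia.
have ch := contract_degree i (Ii i) df.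
have i1j : (i.+1 + j < size a)%N by rewrite addSnnS.
(* By the homotopy formula [contract i f] is a cocycle modulo [I i.+1], hence a coboundary there.
   Lifted to [I i], it is a coboundary plus the [i]-th entry times some [h], and [f] turns out to be
   the coboundary of this [h] modulo [I i]. *)
have [|g gP] := IHj i.+1 i1j (contract i f).
  move=> s sz ct; apply/IP.
  exists (f s), (- contract i (koszul a f) s); split.
    by apply: idealN => //; apply: ch.
  by rewrite -(koszul_contract f sz ia) addrK.
have [h hP] := in_degree_lift (st i ia) gP.
exists h => s sz ct; apply: nzd.
rewrite mulrBr -(koszul_contract f sz ia).
have := koszul_degree (Ii i) hP sz ct.
rewrite !koszulB koszul_koszul koszulZ subr0 => hJ.
rewrite addrAC; apply: idealD => //.
exact: ch.
Qed.

(* Koszul cohomology vanishes in degrees below [size a - r] modulo [J r]; in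
   degree 0 it is [(J r : a) / J r]. *)
Lemma regular_colon a r (I J : nat -> R -> Prop) :
    (forall i, is_ideal (I i)) ->
    (forall i, (i < size a)%N -> regular_step (I i) a`_i (I i.+1)) ->
    (forall x, J 0%N x <-> I 0%N x) -> (forall i, is_ideal (J i)) ->
    (forall i, (i < r)%N -> exists b, regular_step (J i) b (J i.+1)) ->
    (r < size a)%N ->
  forall u, (forall x, x \in a -> J r (u * x)) -> J r u.
Proof.
move=> Ii Ist JI0 Ji Jst ra u ua.
(* Each regular step in [J] costs one degree of exactness. *)
have ex i : (i <= r)%N -> forall j, (i + j < size a)%N -> koszul_exact a (J i) j.
  elim: i => [|i IHi] ir j ij.
    have -> : J 0%N = I 0%N by apply/funext=> x; apply/propext.
    exact: koszul_exact_regular ij.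
  have [b st] := Jst i ir.
  apply: (koszul_exact_step (Ji i) st); apply: (IHi (ltnW ir)).
    exact: ltnW ij.
  by rewrite -addSnnS.
have ra0 : (r + 0 < size a)%N by rewrite addn0.
(* The constant cochain [u] is a cocycle in degree 0, where coboundaries vanish, so exactness puts
   [u] itself in [J r]. *)
have [|g gP] := ex r (leqnn r) 0%N ra0 (fun=> u).
  move=> s _ _; have {ex} := Ji r.
  move: (J r) ua => J' ua J'i.
  elim: a {ra ra0 Ist} s ua => [|x a IHa] [|[] s] ua /=; try exact: ideal0.
    apply: idealB => //; first by rewrite mulrC; apply: ua; rewrite mem_head.
    by apply: IHa => y ya; apply: ua; rewrite inE ya orbT.
  by apply: IHa => y ya; apply: ua; rewrite inE ya orbT.
have := gP (nseq (size a) false).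
rewrite size_nseq count_nseq koszul_degree0 ?subr0 ?count_nseq //; exact.
Qed.

End Koszul.

(** * Edge rings *)

Section IdealGen.
Variable A : comNzRingType.

Lemma ideal_gen_nil (x : A) : x \in ideal_gen [::] <-> x = 0.
Proof.
split=> [/asboolP[c ->]|->]; first by rewrite big_ord0.
by apply/asboolP; exists (fun=> 0); rewrite big_ord0.
Qed.

Lemma ideal_gen_rcons (s : seq A) b x :
  x \in ideal_gen (rcons s b) <->
  exists c y, y \in ideal_gen s /\ x = b * c + y.
Proof.
have E (c : nat -> A) : \sum_(i < size (rcons s b)) c i * (rcons s b)`_i =
    b * c (size s) + \sum_(i < size s) c i * s`_i.
  rewrite size_rcons big_ord_recr /= nth_rcons ltnn eqxx addrC mulrC.
  by congr (_ + _); apply: eq_bigr => i _; rewrite nth_rcons ltn_ord.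
split=> [/asboolP[c ->]|[c [_ [/asboolP[d ->] ->]]]].
  rewrite E; exists (c (size s)), (\sum_(i < size s) c i * s`_i); split=> //.
  by apply/asboolP; exists c.
pose cd i := if i == size s then c else d i.
apply/asboolP; exists cd; rewrite E /cd eqxx; congr (_ + _); apply: eq_bigr => i _.
by rewrite (ltn_eqF (ltn_ord i)).
Qed.

Lemma ideal_gen_is_ideal (s : seq A) : is_ideal (fun x => x \in ideal_gen s).
Proof.
split=> [|x y /asboolP[c ->] /asboolP[d ->]|a x /asboolP[c ->]].
- by apply/asboolP; exists (fun=> 0); rewrite big1 // => i _; rewrite mul0r.
- apply/asboolP; exists (fun i => c i + d i).
  by rewrite -big_split; apply: eq_bigr => i _; rewrite mulrDl.
- apply/asboolP; exists (fun i => a * c i).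
  by rewrite mulr_sumr; apply: eq_bigr => i _; rewrite mulrA.
Qed.

Lemma mem_ideal_gen (s : seq A) x : x \in s -> x \in ideal_gen s.
Proof.
move=> xs; apply/asboolP; exists (fun i => (i == index x s)%:R).
have xi : (index x s < size s)%N by rewrite index_mem.
rewrite (bigD1 (Ordinal xi)) //= eqxx mul1r nth_index // big1 ?addr0 // => i.
by rewrite -val_eqE /= => /negbTE->; rewrite mul0r.
Qed.

End IdealGen.

(** * Substitution endomorphisms of the polynomial ring *)

Section Substitution.
Variables (K : fieldType) (T : finType).
Local Notation R := {mpoly K[#|T|]}.
Local Notation z := (vertex_var K).
Implicit Types (h k : T -> R) (g : R) (v : T) (W F : {set T}).

Definition subst h : R -> R := mmap (@mpolyC #|T| K) (fun i => h (enum_val i)).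

HB.instance Definition _ h := GRing.RMorphism.copy (subst h)
  (mmap (@mpolyC #|T| K) (fun i => h (enum_val i))).

Lemma substC h c : subst h c%:MP = c%:MP.
Proof. exact: mmapC. Qed.

Lemma substX h v : subst h (z v) = h v.
Proof. by rewrite /subst /vertex_var mmapX mmap1U enum_rankK. Qed.

Lemma eq_subst h k : h =1 k -> subst h =1 subst k.
Proof. by move=> /funext->. Qed.

Lemma rmorph_mpoly_ext (f f' : {rmorphism R -> R}) :
  (forall c, f c%:MP = f' c%:MP) -> (forall v, f (z v) = f' (z v)) -> f =1 f'.
Proof.
move=> fC fX g; rewrite (mpolyE g) !rmorph_sum; apply: eq_bigr => m _.
rewrite -mul_mpolyC !rmorphM fC; congr (_ * _).
rewrite mpolyXE_id !rmorph_prod; apply: eq_bigr => i _.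
by rewrite !rmorphXn; congr (_ ^+ _); have := fX (enum_val i);
  rewrite /vertex_var enum_valK.
Qed.

Lemma subst_comp h k g :
  subst h (subst k g) = subst (fun v => subst h (k v)) g.
Proof.
apply: (@rmorph_mpoly_ext (subst h \o subst k)) => [c|v] /=.
  by rewrite !substC.
by rewrite !substX.
Qed.

Lemma substXm h m : subst h 'X_[m] = \prod_i h (enum_val i) ^+ m i.
Proof. exact: mmapX. Qed.

Lemma vertex_var_neq0 v : z v != 0.
Proof.
apply/eqP => /(congr1 (subst (fun=> 1))); rewrite substX rmorph0.
by move/eqP; rewrite oner_eq0.
Qed.

Lemma vertex_var_neq1 v : z v - 1 != 0.
Proof.
apply/eqP => /(congr1 (subst (fun=> 0))).
rewrite rmorphB /= substX rmorph1 rmorph0 sub0r => /eqP.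
by rewrite oppr_eq0 oner_eq0.
Qed.

Definition face_val W F v : R := if v \in F then 1 else if v \in W then z v else 0.

(* The restriction to the coordinate subspace of [W], with the variables of [F]
   specialized to 1. *)
Definition face_map W F : R -> R := subst (face_val W F).

HB.instance Definition _ W F :=
  GRing.RMorphism.copy (face_map W F) (subst (face_val W F)).

Lemma face_mapX W F v : face_map W F (z v) = face_val W F v.
Proof. exact: substX. Qed.

Lemma face_mapC W F c : face_map W F c%:MP = c%:MP.
Proof. exact: substC. Qed.

(** A variable that the inner map sets to 1 or to 0 gets the same value from the outer map. *)
Lemma face_map_comp W F W' F' : F' \subset F -> F :|: W \subset F' :|: W' ->
  face_map W F \o face_map W' F' =1 face_map W F.
Proof.
move=> /subsetP FF /subsetP WW g; rewrite /= /face_map subst_comp.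
apply: eq_subst => v; rewrite /face_val; case: ifP => vF'.
  by rewrite rmorph1 FF.
have := WW v; rewrite !inE vF' /=; case: ifP => vW' h.
  by rewrite substX.
rewrite rmorph0; move: h.
by case: (v \in F) => [/(_ isT)//|] /=; case: (v \in W) => [/(_ isT)|].
Qed.

(** The polynomials with this property are closed under sums and products and include the constants
    and the variables. *)
Lemma subst_retract v g : exists c, g = (z v - 1) * c +
  subst (fun w => if w == v then 1 else z w) g.
Proof.
pose f : {rmorphism R -> R} := subst (fun w => if w == v then 1 else z w).
pose P (g : R) := exists c, g = (z v - 1) * c + f g.
have PD g1 g2 : P g1 -> P g2 -> P (g1 + g2).
  case=> c1 E1 [c2 E2]; exists (c1 + c2).
  by rewrite rmorphD {1}E1 {1}E2; ring.
have PM g1 g2 : P g1 -> P g2 -> P (g1 * g2).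
  case=> c1 E1 [c2 E2]; exists (c1 * g2 + f g1 * c2).
  by rewrite rmorphM {1}E1 mulrDl mulrDr [in f g1 * g2]E2; ring.
have PC c : P c%:MP by exists 0; rewrite /f /= substC mulr0 add0r.
have P1 : P 1 by exists 0; rewrite rmorph1 mulr0 add0r.
have PX w : P (z w).
  rewrite /P /f /= substX; case: eqVneq => [->|_]; first by exists 1; ring.
  by exists 0; ring.
rewrite -[exists c, _]/(P g) (mpolyE g); elim/big_ind: _ => [|g1 g2|m _].
- by exists 0; rewrite rmorph0 mulr0 add0r.
- exact: PD.
rewrite -mul_mpolyC; apply: (PM) => //.
rewrite mpolyXE_id; elim/big_ind: _ => // i _.
elim: (m i) => [|k IHk]; first by rewrite expr0.
rewrite exprS; apply: PM => //.
by have := PX (enum_val i); rewrite /vertex_var enum_valK.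
Qed.

End Substitution.

(** * Stanley-Reisner description of the edge ideal *)

Section FaceIdeals.
Variables (K : fieldType) (T : finType) (e : rel T).
Hypothesis eI : irreflexive e.
Local Notation R := {mpoly K[#|T|]}.
Local Notation z := (vertex_var K).
Implicit Types (g : R) (v : T) (W F : {set T}).

(* The ideal generated by the edge ideal and the [z f - 1] for [f] in [F], as
   an intersection of kernels over the faces containing [F]. *)
Definition face_ideal F g :=
  forall W, independent e W -> F \subset W -> face_map W F g = 0.

Lemma face_ideal_is_ideal F : is_ideal (face_ideal F).
Proof.
split=> [W _ _|x y xF yF W iW FW|c x xF W iW FW].
- by rewrite rmorph0.
- by rewrite rmorphD /= xF ?yF ?addr0.
- by rewrite rmorphM /= xF ?mulr0.
Qed.

(** On each face [z f - 1] restricts to itself or to -1, a nonzero element of a domain. *)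
Lemma face_ideal_step F f : f \notin F ->
  regular_step (face_ideal F) (z f - 1) (face_ideal (f |: F)).
Proof.
move=> fF; split=> [g|g gF W iW FW]; last first.
  have := gF W iW FW; rewrite rmorphM rmorphB rmorph1 /= face_mapX /face_val.
  rewrite (negbTE fF) => /eqP; rewrite mulf_eq0 => /orP[|/eqP//].
  case: ifP => _; first by rewrite (negbTE (vertex_var_neq1 K f)).
  by rewrite sub0r oppr_eq0 oner_eq0.
split=> [gF|[c [y [yF ->]]] W iW]; last first.
  rewrite subUset sub1set => /andP[fW FW].
  rewrite rmorphD rmorphM rmorphB rmorph1 /= face_mapX /face_val setU11 subrr mul0r.
  rewrite add0r -(face_map_comp (W := W) (W' := W) (subsetUr [set f] F)) /=.
    by rewrite yF // rmorph0.
  by rewrite -setUA subUset sub1set inE fW orbT subxx.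
have [c gE] := subst_retract f g; move: gE.
set g' := subst _ _ => gE.
(* [g'] alone need not vanish on faces without [f]; the factor [z f] kills those, and on faces with
   [f] the restriction of [g'] is that of [g] with [z f] set to 1. *)
exists (c - g'), (z f * g'); split; last by rewrite {1}gE; ring.
move=> W iW FW; rewrite rmorphM /= face_mapX /face_val (negbTE fF).
case: ifP => [fW|]; last by rewrite mul0r.
suff -> : face_map W F g' = face_map W (f |: F) g.
  by rewrite gF ?mulr0 // subUset sub1set fW.
rewrite /face_map subst_comp; apply: eq_subst => v; rewrite /face_val !inE.
by case: eqVneq => [_|_] /=; rewrite ?rmorph1 ?substX.
Qed.

(** A monomial of [g] with independent support [W] would survive restriction to [W], so every
    monomial of [g] is divisible by an edge. *)
Lemma edge_idealP g : g \in edge_ideal e <-> face_ideal set0 g.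
Proof.
have idI := ideal_gen_is_ideal [seq vertex_var K p.1 * vertex_var K p.2
            | p <- enum [pred p : T * T | e p.1 p.2]].
split=> [/asboolP[c ->] W /independentP iW _|gF].
  rewrite rmorph_sum big1 // => i _; rewrite rmorphM.
  set s := [seq _ | _ <- _] in i *.
  have /mapP[[u v]] : s`_i \in s by apply: mem_nth.
  rewrite mem_enum inE /= => uv ->; rewrite rmorphM /= !face_mapX /face_val !inE.
  case: ifP => [uW|_]; last by rewrite mul0r mulr0.
  case: ifP => [vW|_]; last by rewrite !mulr0.
  by have := iW _ _ uW vW; rewrite uv.
rewrite (mpolyE g) big_seq; elim/big_ind: _ => [|g1 g2|m mg].
- exact: ideal0 idI.
- exact: (idealD idI).
rewrite -mul_mpolyC; apply: (idealM _ idI).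
pose W := [set v | (0 < m (enum_rank v))%N].
case: (boolP (independent e W)) => [iW|].
  (* Restriction to [W] keeps exactly the monomials supported in [W]. *)
  have rX m' : face_map W set0 'X_[m'] =
      if [forall i, (0 < m' i) ==> (0 < m i)]%N then 'X_[m'] else 0 :> R.
    rewrite /face_map substXm; case: ifPn => [/forall_inP h|].
      rewrite mpolyXE_id; apply: eq_bigr => i _; rewrite /face_val !inE enum_valK.
      case: (posnP (m' i)) => [->|/h ->]; first by rewrite !expr0.
      by rewrite /vertex_var enum_valK.
    rewrite negb_forall => /existsP[i]; rewrite negb_imply => /andP[m'i mi].
    rewrite (bigD1 i) //= /face_val !inE enum_valK (negbTE mi) expr0n.
    by rewrite gtn_eqF // mul0r.
  have := congr1 (mcoeff m) (gF W iW (sub0set W)).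
  rewrite {1}(mpolyE g) rmorph_sum raddf_sum (bigD1_seq m) //= ?msupp_uniq //.
  rewrite big1 => [|m' m'm]; rewrite -mul_mpolyC rmorphM /=;
    rewrite face_mapC rX mcoeffCM.
    case: ifP => [_|/forallP[]] //; last by move=> i; apply/implyP.
    rewrite mcoeff0 addr0 mcoeffX eqxx mulr1 => /eqP.
    by rewrite mcoeff_eq0 mg.
  by case: ifP => _; rewrite ?mcoeff0 ?mcoeffX ?(negbTE m'm) mulr0.
rewrite negb_forall => /existsP[u]; rewrite negb_imply => /andP[].
rewrite inE => mu; rewrite negb_forall => /existsP[v]; rewrite negb_imply.
rewrite inE negbK => /andP[mv uv].
have um : (U_(enum_rank u) + U_(enum_rank v) <= m)%MM.
  apply/mnm_lepP => i; rewrite mnmDE !mnm1E.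
  case: (eqVneq _ i) => [<-|_].
    case: eqVneq => [/enum_rank_inj vu|_]; last by rewrite addn0.
    by move: uv; rewrite vu eI.
  by case: eqVneq => [<-|_].
rewrite -(submK um) mpolyXD; apply: (idealM _ idI); apply: mem_ideal_gen.
rewrite mpolyXD; apply/mapP; exists (u, v) => //.
by rewrite mem_enum.
Qed.

End FaceIdeals.

(** * Height and depth at the point of a face with complete bipartite link *)

Section BipartiteLink.
Variables (K : fieldType) (T : finType) (e : rel T).
Hypothesis eI : irreflexive e.
Local Notation R := {mpoly K[#|T|]}.
Local Notation A := (edge_ring K e).
Local Notation z := (vertex_var K).
Implicit Types (g : R) (v : T) (W F : {set T}).

Lemma pi_eq0 g : (\pi_A g == 0) = (g \in edge_ideal e).
Proof. by rewrite -(rmorph0 \pi_A) -Quotient.idealrBE subr0. Qed.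

Lemma pi_subst_repr (h : T -> R) g :
  (forall u v, e u v -> h u * h v = 0) -> subst h (repr (\pi_A g)) = subst h g.
Proof.
move=> hE; apply/eqP; rewrite -subr_eq0 -rmorphB; apply/eqP.
have : repr (\pi_A g) - g \in edge_ideal e by rewrite Quotient.idealrBE reprK.
move: (_ - g) => x /asboolP[c ->].
rewrite rmorph_sum big1 // => i _; rewrite rmorphM.
set s := [seq _ | _ <- _] in i *.
have /mapP[[u v]] : s`_i \in s by apply: mem_nth.
by rewrite mem_enum inE /= => uv ->; rewrite rmorphM /= !substX hE ?mulr0.
Qed.

(** Read off on representatives; for [h] killing every edge, [pi_subst_repr] makes it the kernel of
    the induced map on the edge ring. *)
Definition subst_ker (h : T -> R) : {pred A} := fun x => subst h (repr x) == 0.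

Section SubstKer.
Variable h : T -> R.
Hypothesis hE : forall u v, e u v -> h u * h v = 0.

Lemma mem_subst_ker g : (\pi_A g \in subst_ker h) = (subst h g == 0).
Proof. by rewrite unfold_in /subst_ker pi_subst_repr. Qed.

Lemma subst_ker_closed : idealr_closed (subst_ker h).
Proof.
split.
- by rewrite -(rmorph0 \pi_A) mem_subst_ker rmorph0.
- by rewrite -(rmorph1 \pi_A) mem_subst_ker rmorph1 oner_eq0.
- move=> a x y; rewrite -[a]reprK -[x]reprK -[y]reprK -rmorphM -rmorphD.
  rewrite !mem_subst_ker rmorphD rmorphM /= => /eqP-> /eqP->.
  by rewrite mulr0 addr0.
Qed.

Lemma subst_ker_prime : prime_ideal (subst_ker h).
Proof.
split; first exact: subst_ker_closed.
move=> x y; rewrite -[x]reprK -[y]reprK -rmorphM !mem_subst_ker rmorphM.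
by rewrite mulf_eq0.
Qed.

Lemma subst_ker_maximal : (forall v, exists c, h v = c%:MP) ->
  maximal_ideal (subst_ker h).
Proof.
move=> hC; split=> [|I Ic sub x]; first exact: subst_ker_closed.
have [I0 I1 Iadd] := Ic.
have subst_const g : exists c, subst h g = c%:MP.
  have /choice[p hp] := hC; exists (meval (fun i => p (enum_val i)) g).
  apply: (@rmorph_mpoly_ext _ _ (subst h)
    (@mpolyC _ _ \o meval (fun i => p (enum_val i)))) => [c|v] /=.
    by rewrite substC mevalC.
  by rewrite substX hp /vertex_var mevalXU enum_rankK.
apply/idP/idP => [xI|]; last exact: sub.
rewrite -[x]reprK mem_subst_ker; have [c hc] := subst_const (repr x).
rewrite hc mpolyC_eq0; apply/negP => /negP c0; case/negP: I1.
have : \pi_A c%:MP \in I.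
  (* An element outside the kernel differs from a nonzero constant [c] by an element of the kernel,
     so [I] would contain a unit. *)
  have -> : \pi_A c%:MP = - 1 * \pi_A (repr x - c%:MP) + x :> A.
    by rewrite rmorphB /= reprK; ring.
  apply: Iadd => //; apply: sub; rewrite mem_subst_ker rmorphB /= substC hc.
  by rewrite subrr.
move=> cI; have := Iadd (\pi_A (c^-1)%:MP) _ _ cI I0.
by rewrite addr0 -rmorphM -mpolyCM mulVf ?mpolyC1 ?rmorph1.
Qed.

End SubstKer.

(** Pulls the ideals back to the polynomial ring, where the Koszul argument is carried out. *)
Lemma regular_sequence_lift (s : seq A) : regular_sequence s ->
  forall i, (i < size s)%N ->
  regular_step (fun g => \pi_A g \in ideal_gen (take i s)) (repr s`_i)
               (fun g => \pi_A g \in ideal_gen (take i.+1 s)).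
Proof.
move=> [reg _] i si; split=> [g|g]; last first.
  by rewrite rmorphM /= reprK; apply: reg.
rewrite (take_nth 0) //; split.
  case/ideal_gen_rcons => c [y [yJ gE]].
  exists (repr c), (g - repr s`_i * repr c); split; last by ring.
  by rewrite rmorphB rmorphM /= !reprK gE addrC addKr.
case=> c [y [yJ ->]]; apply/ideal_gen_rcons; exists (\pi_A c), (\pi_A y).
by rewrite rmorphD rmorphM /= reprK.
Qed.

Variables F X Y : {set T}.
Hypotheses (iFX : independent e (F :|: X)) (iFY : independent e (F :|: Y)).
Hypotheses (FX : [disjoint F & X]) (FY : [disjoint F & Y])
  (XY : [disjoint X & Y]).
Hypothesis eXY : {in X & Y, forall x y, e x y}.
Hypothesis cover : forall u, u \notin F -> u \notin X -> u \notin Y ->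
  exists2 f, f \in F & e f u.

(* The chain evaluates the vertices of the face [F :|: X] one at a time at the
   point with coordinate 1 on [F] and 0 elsewhere. *)
Definition flag_val (i : nat) v : R :=
  if v \in take i (enum (F :|: X)) then (v \in F)%:R
  else if v \in F :|: X then z v else 0.

Lemma flag_val_edge i u v : e u v -> flag_val i u * flag_val i v = 0.
Proof.
move=> uv; rewrite /flag_val.
have out w : w \notin F :|: X -> w \notin take i (enum (F :|: X)).
  by apply: contra => /mem_take; rewrite mem_enum.
have [uW|uW] := boolP (u \in F :|: X); last first.
  by rewrite (negbTE (out _ uW)) mul0r.
have [vW|vW] := boolP (v \in F :|: X); last first.
  by rewrite (negbTE (out _ vW)) mulr0.
by have := independentP _ _ iFX _ _ uW vW; rewrite uv.
Qed.

Definition point_val := flag_val #|F :|: X|.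

Lemma point_valE v : point_val v = (v \in F)%:R.
Proof.
rewrite /point_val /flag_val cardE.
rewrite take_size mem_enum; case: (boolP (_ \in _ :|: _)) => //.
by rewrite inE => /norP[/negbTE->].
Qed.

Lemma flag_chain :
  prime_chain (subst_ker point_val) #|F :|: X|
    (fun i => subst_ker (flag_val i)).
Proof.
have fE := flag_val_edge.
split=> [i _|i iW|//]; first exact/subst_ker_prime/fE.
have si : (i < size (enum (F :|: X)))%N by rewrite -cardE.
have [w0 _] : exists w, w \in F :|: X.
  by apply/set0Pn; rewrite -card_gt0; apply: leq_ltn_trans iW.
pose w := nth w0 (enum (F :|: X)) i.
have tk : take i.+1 (enum (F :|: X)) = rcons (take i (enum (F :|: X))) w.
  exact: take_nth.
have wW : w \in F :|: X by rewrite -mem_enum mem_nth.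
have wi : w \notin take i (enum (F :|: X)).
  have := take_uniq i.+1 (enum_uniq (F :|: X)).
  by rewrite tk rcons_uniq => /andP[].
split=> [x|].
  rewrite -[x]reprK !(mem_subst_ker (fE _)) => /eqP x0.
  suff -> : subst (flag_val i.+1) (repr x) =
      subst (flag_val i.+1) (subst (flag_val i) (repr x)).
    by rewrite x0 rmorph0.
  rewrite subst_comp; apply: eq_subst => v.
  rewrite {3}/flag_val; case: ifP => vi.
    by rewrite rmorph_nat /flag_val tk mem_rcons inE vi orbT.
  case: ifP => vW; first by rewrite substX.
  rewrite rmorph0 /flag_val vW; case: ifP => // /mem_take.
  by rewrite mem_enum vW.
(* Strictness: the variable of the newly evaluated vertex [w], minus its coordinate, enters the
   kernel at this very step. *)
move=> /(_ (\pi_A (z w - (w \in F)%:R))); rewrite !(mem_subst_ker (fE _)).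
rewrite !rmorphB !rmorph_nat /= !substX {1}/flag_val tk mem_rcons mem_head subrr.
rewrite eqxx /flag_val (negbTE wi) wW => /(_ isT).
case: (w \in F); first by rewrite (negbTE (vertex_var_neq1 _ _)).
by rewrite subr0 (negbTE (vertex_var_neq0 _ _)).
Qed.

Local Notation rX := (face_map (F :|: X) F).
Local Notation rY := (face_map (F :|: Y) F).

(** Two faces suffice: by [cover] an independent set containing [F] lies in [F :|: X :|: Y], and it
    cannot meet both [X] and [Y]. *)
Lemma face_idealP g : face_ideal e F g <-> rX g = 0 /\ rY g = 0.
Proof.
split=> [gF|[gX gY] W iW FW]; first by split; apply: gF; rewrite // subsetUl.
have restrict Z : W \subset F :|: Z -> face_map (F :|: Z) F g = 0 ->
    face_map W F g = 0.
  move=> WZ gZ; rewrite -(face_map_comp (W' := F :|: Z) (subxx F)) /=.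
    by rewrite gZ rmorph0.
  by rewrite subUset subsetUl setUA setUid.
have [|/subsetPn[w wW wFX]] := boolP (W \subset F :|: X).
  by move/restrict; apply.
have /independentP iWP := iW.
have inY u : u \in W -> u \notin F -> u \notin X -> u \in Y.
  move=> uW uF uX; apply/negPn/negP => uY; have [f fF fu] := cover uF uX uY.
  by have := iWP _ _ (subsetP FW _ fF) uW; rewrite fu.
have wY : w \in Y by move: wFX; rewrite inE => /norP[wF wX]; apply: inY.
apply: (restrict Y) => //; apply/subsetP=> u uW; rewrite inE.
case: (boolP (u \in F)) => //= uF; apply: inY => //.
by apply/negP => uX; have := iWP _ _ uW wW; rewrite eXY.
Qed.

Variables x y : T.
Hypotheses (xX : x \in X) (yY : y \in Y).

Lemma face_vals :
  [/\ rX (z x) = z x, rX (z y) = 0, rY (z x) = 0 & rY (z y) = z y].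
Proof.
have xF : x \in F = false by apply: disjointFl FX xX.
have yF : y \in F = false by apply: disjointFl FY yY.
have xY : x \in Y = false by apply: disjointFr XY xX.
have yX : y \in X = false by apply: disjointFl XY yY.
by rewrite !face_mapX /face_val !inE xF yF xY yX xX yY.
Qed.

Lemma face_point (Z : {set T}) g :
  subst point_val (face_map (F :|: Z) F g) =
  subst point_val g.
Proof.
rewrite /face_map subst_comp; apply: eq_subst => v; rewrite /face_val.
case: ifP => vF; first by rewrite rmorph1 point_valE vF.
by case: ifP; rewrite ?substX // rmorph0 point_valE vF.
Qed.

Lemma faces_meet g : rY (rX g) = subst point_val g.
Proof.
rewrite /face_map subst_comp; apply: eq_subst => v.
rewrite point_valE /face_val !inE; case: ifP => vF; first by rewrite rmorph1.
case: ifP => [|_]; last by rewrite rmorph0.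
by rewrite vF /= => vX; rewrite substX inE vF /= (disjointFr XY vX).
Qed.

Definition sum_ideal g :=
  exists c k, face_ideal e F k /\ g = (z x + z y) * c + k.

Lemma sum_ideal_is_ideal : is_ideal sum_ideal.
Proof.
have Fi := face_ideal_is_ideal K e F.
split=> [|g1 g2 [c1 [k1 [k1F ->]]] [c2 [k2 [k2F ->]]]|d g [c [k [kF ->]]]].
- by exists 0, 0; split; [apply: ideal0 Fi | ring].
- by exists (c1 + c2), (k1 + k2); split; [apply: (idealD Fi) | ring].
- by exists (d * c), (d * k); split; [apply: (idealM _ Fi) | ring].
Qed.

(** On the two branches [z x + z y] restricts to [z x] and to [z y], both nonzero. *)
Lemma sum_ideal_step : regular_step (face_ideal e F) (z x + z y) sum_ideal.
Proof.
split=> // g; rewrite !face_idealP !rmorphM !rmorphD /=.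
have [-> -> -> ->] := face_vals; rewrite addr0 add0r.
by move=> [/eqP + /eqP]; rewrite !mulf_eq0 !(negbTE (vertex_var_neq0 _ _)) =>
  /eqP-> /eqP->.
Qed.

Lemma sum_ideal_socle g : subst point_val g = 0 ->
  sum_ideal (z x * g).
(* With cofactor [rX g] both sides restrict to [z x * rX g] on the branch of [X], and to 0 on that
   of [Y], where [rX g] becomes the value of [g] at the point. *)
Proof.
move=> g0; exists (rX g), (z x * g - (z x + z y) * rX g); split; last by ring.
apply/face_idealP; have [Xx Xy Yx Yy] := face_vals.
rewrite !rmorphB !rmorphM !rmorphD /= Xx Xy Yx Yy faces_meet g0.
have -> : rX (rX g) = rX g by apply: face_map_comp.
by split; ring.
Qed.

(** A cofactor [c] would restrict to 1 on the branch of [X] and to 0 on that of [Y], but the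
    branches share the point. *)
Lemma sum_ideal_var : ~ sum_ideal (z x).
Proof.
have [Xx Xy Yx Yy] := face_vals.
move=> [c [k [/face_idealP[kX kY] zE]]].
have /eqP : z x = z x * rX c.
  by rewrite -{1}Xx {1}zE rmorphD rmorphM rmorphD /= Xx Xy kX !addr0.
rewrite -{1}[z x]mulr1 (inj_eq (mulfI (vertex_var_neq0 K x))) => /eqP cX.
have /esym/eqP : 0 = z y * rY c.
  by rewrite -Yx zE rmorphD rmorphM rmorphD /= Yx Yy kY addr0 add0r.
rewrite mulf_eq0 (negbTE (vertex_var_neq0 _ _)) => /eqP cY.
have := face_point X c; rewrite -cX -(face_point Y c) cY rmorph1 rmorph0.
by move/eqP; rewrite oner_eq0.
Qed.

Lemma regular_sequence_bound (s : seq A) : regular_sequence s ->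
  {subset s <= subst_ker point_val} -> (size s <= #|F|.+1)%N.
Proof.
move=> reg sM; rewrite leqNgt; apply/negP => ss.
apply: sum_ideal_var.
(* The vertices of [F] enter one at a time, then [z x + z y] as step [#|F|.+1]; a longer [s] would
   force [z x] into the last ideal. *)
pose J i := if (i <= #|F|)%N then face_ideal e [set v in take i (enum F)]
            else sum_ideal.
have JF : sum_ideal = J #|F|.+1 by rewrite /J ltnn.
have sz : size [seq repr a | a <- s] = size s by rewrite size_map.
rewrite JF; apply: (@regular_colon _ [seq repr a | a <- s] #|F|.+1
  (fun i g => \pi_A g \in ideal_gen (take i s)) J).
- move=> i; have [I0 Iadd Imul] := ideal_gen_is_ideal (take i s); split.
  + by rewrite rmorph0.
  + by move=> g k; rewrite rmorphD; apply: Iadd.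
  + by move=> c g; rewrite rmorphM; apply: Imul.
- move=> i; rewrite sz => si; rewrite (nth_map 0) //.
  exact: regular_sequence_lift.
- move=> g; rewrite /J leq0n take0.
  have -> : [set v in [::]] = set0 :> {set T} by apply/setP=> v; rewrite !inE.
  rewrite take0; split=> [/(edge_idealP eI)|/ideal_gen_nil/eqP].
    by rewrite -pi_eq0 => /eqP->; apply/ideal_gen_nil.
  by rewrite pi_eq0 => /(edge_idealP eI).
- move=> i; rewrite /J; case: ifP => _; first exact: face_ideal_is_ideal.
  exact: sum_ideal_is_ideal.
- move=> i; rewrite ltnS leq_eqVlt => /orP[/eqP->|iF].
    exists (z x + z y); rewrite /J leqnn ltnn cardE take_size.
    have -> : [set v in enum F] = F by apply/setP=> v; rewrite inE mem_enum.
    exact: sum_ideal_step.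
  have si : (i < size (enum F))%N by rewrite -cardE.
  pose f := nth x (enum F) i; exists (z f - 1); rewrite /J iF ltnW //.
  have tk : take i.+1 (enum F) = rcons (take i (enum F)) f by apply: take_nth.
  have -> : [set v in take i.+1 (enum F)] = f |: [set v in take i (enum F)].
    by apply/setP=> v; rewrite tk !inE mem_rcons inE.
  apply: face_ideal_step; rewrite inE.
  by have := take_uniq i.+1 (enum_uniq F); rewrite tk rcons_uniq => /andP[].
- by rewrite sz.
move=> _ /mapP[a /sM aM ->]; rewrite -JF; apply: sum_ideal_socle.
exact/eqP.
Qed.

Lemma not_cohen_macaulay :
  (#|F|.+1 < #|F :|: X|)%N -> ~ cohen_macaulay_graph K e.
Proof.
move=> ltF [_ CM].
have [|n [[_ ht] [[s [reg sM sn]] _]]] := CM (subst_ker point_val).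
  apply: subst_ker_maximal; first exact: flag_val_edge.
  by move=> v; exists (v \in F)%:R; rewrite point_valE mpolyC_nat.
have := leq_trans (ht _ _ flag_chain) _; rewrite -sn.
move=> /(_ _ (regular_sequence_bound reg sM)).
by rewrite leqNgt ltF.
Qed.

End BipartiteLink.

Theorem lemma3p2 (K : fieldType) (T : finType) (e : rel T) :
  simple_graph e -> (0 < #|T|)%N ->
  very_well_covered e -> cohen_macaulay_graph K e ->
  (2 <= #|[set v | leaf e v]|)%N.
Proof.
move=> eG T0 eW CM; have [s [sK es]] := perfect_matching eG eW.
apply: (two_leaves eG eW sK es T0) => v w vw.
apply/eqP/negPn/negP => neq; have [_ eI] := eG.
have [F [X [Y [[iFX iFY cFX ltF] FX FY XY [X0 Y0 eXY cov]]]]] :=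
  twin_split eG eW sK es neq vw.
have [x xX] := set0Pn _ X0; have [y yY] := set0Pn _ Y0.
by apply: (not_cohen_macaulay eI iFX iFY FX FY XY eXY cov xX yY _ CM); rewrite cFX.
Qed.
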